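(* Let $n\ge 1$ be an integer. There is a bijection $\varphi:\mathcal{P}_n\to\mathcal{D}_{n-1,n}$ from the set $\mathcal{P}_n$ of plane trees on $[n]$ to the set $\mathcal{D}_{n-1,n}$ of dispositions from $[n-1]$ to $[n]$ such that, for every $T\in\mathcal{P}_n$ with $\varphi(T)=D=(D_1,D_2,\dots,D_n)$, $$\mathrm{young}_T(i)=\mathrm{RLmin}(D_i)\quad\text{for all } i\in[n].$$
   Context: For a nonnegative integer $k$, $[k]=\{1,2,\dots,k\}$ (so $[0]=\emptyset$). Plane trees: a plane tree on $[n]$ is a labeled rooted tree with vertex set $[n]$ (any vertex may be the root) in which the children of each vertex are linearly ordered (from left to right). A vertex $j$ is a descendant of $i$ if $i$ lies on the unique path from the root to $j$; in particular every vertex is a descendant of itself. Let $\beta_T(i)$ be the smallest descendant of $i$ in $T$. Vertices with the same father are brothers. A vertex $j$ is an elder vertex if it has a brother $k$ to its right with $\beta_T(k)<\beta_T(j)$; otherwise it is a younger vertex. $\mathrm{young}_T(i)$ denotes the number of children of $i$ in $T$ that are younger vertices. Dispositions: a disposition from $[m]$ to $[n]$ is a function $f:[m]\to[n]$ together with a linear order on each pre-image $f^{-1}(i)$, $i\in[n]$. It is written $D=(D_1,\dots,D_n)$, where $D_i$ is the (possibly empty) sequence listing the elements of $f^{-1}(i)$ in the chosen linear order. For a sequence $\pi=\pi_1\cdots\pi_k$ of distinct integers, $\pi_i$ is a right-to-left minimum if $\pi_i<\pi_j$ for every $j>i$ (so the last entry is always one). $\mathrm{RLmin}(D_i)$ is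 the number of right-to-left minima of $D_i$ (which is $0$ if $D_i$ is empty). *)

(* Defs.v *)
From HB Require Import structures.
From mathcomp Require Import all_boot.

Set Implicit Arguments.
Unset Strict Implicit.
Unset Printing Implicit Defensive.

(* The set [k] = {1, ..., k} is represented by 'I_k = {0, ..., k-1}: labels    *)
(* matter only through their order, so the shift by one is immaterial.        *)

Section PlaneTreeData.

Variable n : nat.

Definition child_rel (ch : {ffun 'I_n -> seq 'I_n}) : rel 'I_n :=
  fun i j => j \in ch i.

(* A rooted tree whose children are listed from left to right: no vertex is   *)
(* listed twice by the same father, the root has no father, every other       *)
(* vertex has exactly one, and every vertex is reached from the root.         *)
Definition is_plane_tree (rc : 'I_n * {ffun 'I_n -> seq 'I_n}) : bool :=
  let: (r, ch) := rc in
  [&& [forall i, uniq (ch i)],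
      [forall j, #|[set i | child_rel ch i j]| == (j != r)]
    & [forall j, connect (child_rel ch) r j]].

Record plane_tree : Type := PlaneTree {
  pt_data :> 'I_n * {ffun 'I_n -> seq 'I_n};
  _ : is_plane_tree pt_data }.

HB.instance Definition _ := [isSub for pt_data].
HB.instance Definition _ := [Choice of plane_tree by <:].

Variable T : plane_tree.

Definition tree_root : 'I_n := T.1.
Definition children (i : 'I_n) : seq 'I_n := T.2 i.

Definition child (i j : 'I_n) : bool := j \in children i.

Definition descendant (i j : 'I_n) : bool := connect child i j.

Definition beta (i : 'I_n) : 'I_n := [arg min_(j < i | descendant i j) val j].

Definition right_brother (j k : 'I_n) : bool :=
  [exists i, [&& j \in children i, k \in children i
               & index j (children i) < index k (children i)]].

Definition elder (j : 'I_n) : bool :=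
  [exists k, right_brother j k && (beta k < beta j)].

Definition younger (j : 'I_n) : bool := ~~ elder j.

Definition young (i : 'I_n) : nat :=
  #|[set j | (j \in children i) && younger j]|.

End PlaneTreeData.

Lemma connect_root n (T : plane_tree n) j : connect (child T) (tree_root T) j.
Proof.
by case: T => [[r ch] /= H]; case/and3P: (H) => _ _ /forallP /(_ j).
Qed.

(* The vertices below i are those j such that i lies on the path from the     *)
(* root to j (paths start at the root and follow the child relation).         *)
Lemma descendantP n (T : plane_tree n) (i j : 'I_n) :
  reflect (exists p, [/\ path (child T) (tree_root T) p, last (tree_root T) p = j
                       & i \in tree_root T :: p])
          (descendant T i j).
Proof.
apply: (iffP idP) => [|[p [Tp <- /splitPl ip]]].
  have /connectP[p1 Tp1 ->] := connect_root T i.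
  case/connectP=> p2 Tp2 ->; exists (p1 ++ p2).
  rewrite cat_path Tp1 Tp2 last_cat; split=> //.
  by rewrite -cat_cons mem_cat mem_last.
case: ip Tp => p1 p2 <-; rewrite cat_path last_cat => /andP[_ Tp2].
by apply/connectP; exists p2.
Qed.

Section Dispositions.

Variables m n : nat.

(* A function f : [m] -> [n] together with, for each i, a listing D_i of the  *)
(* pre-image of i without repetition, i.e., a linear order on it.             *)
Definition is_disposition
    (fD : {ffun 'I_m -> 'I_n} * {ffun 'I_n -> seq 'I_m}) : bool :=
  let: (f, D) := fD in
  [forall i, perm_eq (D i) (enum [set j | f j == i])].

Record disposition : Type := Disposition {
  disp_data :> {ffun 'I_m -> 'I_n} * {ffun 'I_n -> seq 'I_m};
  _ : is_disposition disp_data }.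

HB.instance Definition _ := [isSub for disp_data].
HB.instance Definition _ := [Choice of disposition by <:].

Definition disp_fun (D : disposition) (j : 'I_m) : 'I_n := D.1 j.
Definition disp_seq (D : disposition) (i : 'I_n) : seq 'I_m := D.2 i.

End Dispositions.

Definition is_RLmin (s : seq nat) (i : nat) : bool :=
  [forall j : 'I_(size s), (i < j) ==> (nth 0 s i < nth 0 s j)].

Definition RLmin (s : seq nat) : nat := #|[set i : 'I_(size s) | is_RLmin s i]|.

(* Main.v *)
Require Import Defs.
From mathcomp Require Import all_boot.

Set Implicit Arguments.
Unset Strict Implicit.
Unset Printing Implicit Defensive.

(** The bijection is the inverse of a decoding of dispositions into trees, a
variant of the Foata-Fuchs coding of rooted trees in which the paths lead to
the least vertices rather than to the leaves.

Let n = N + 1 and let c 0, ..., c (N - 1) be the values of the function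
underlying a disposition D.  The vertices are visited one by one: the root
v 0 = c 0 first, then v (t + 1) as a child of c t, where v (t + 1) is c (t + 1)
if that vertex is new, and the least unvisited vertex otherwise.  As c t is
visited by time t, this is a rooted tree on [n].  The children of i are listed
as the vertices v (t + 1), for t in the order given by D_i.

In the tree, v (t + 1) is an ancestor of the least vertex m_t that is still
unvisited when it is attached: if v (t + 1) is not m_t itself, then it equals
c (t + 1), so v (t + 2) is its child, while the least unvisited vertex remains
m_t.  The code thus follows a path down to m_t before it starts another one.
Two consequences carry the proof.

- The vertex v (t + 1) is the only unvisited ancestor of m_t whose father is
  visited ([attaches_unique]).  So a tree determines its order of visits, hence
  its code and its disposition ([decode_inj]).  Conversely, growing any tree by
  attaching this vertex repeatedly, and recording the fathers, yields a code
  that decodes to the tree ([next_visit_tree_code], [decode_surj]).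

- The least descendant of v (t + 1) is m_t, and m_t strictly increases along
  brothers ([beta_brothers]).  So the least descendants of the successive
  children of i compare as the entries of D_i do.  A child is younger when its
  least descendant is smaller than that of every brother to its right, so the
  younger children are those that correspond to right-to-left minima
  ([young_RLmin]). *)

(** * Least element outside a set *)

Section LeastOutside.

Variable N : nat.
Implicit Type S : {set 'I_N.+1}.

Definition least_outside S : 'I_N.+1 :=
  odflt ord0 [pick x | (x \notin S) && [forall y, (y \notin S) ==> (x <= y)]].

Lemma least_outsideP S y :
  y \notin S -> least_outside S \notin S /\ least_outside S <= y.
Proof.
rewrite /least_outside; case: pickP => [x /andP[xS /forallP xP] yS | none yS] /=.
  by split=> //; apply: (implyP (xP y)).
case: (@arg_minnP _ y [pred x | x \notin S] val yS) => x /= xS xP.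
have := none x; rewrite xS /= => /negbT /forallP[] z.
by apply/implyP; apply: xP.
Qed.

Lemma least_outside_eq S x :
  x \notin S -> (forall y, y \notin S -> x <= y) -> least_outside S = x.
Proof.
move=> xS xP; have [mS mx] := least_outsideP xS.
by apply/val_inj/eqP; rewrite /= eqn_leq mx xP.
Qed.

Lemma least_outsideU1 S w :
  w \notin S -> w != least_outside S ->
  least_outside (w |: S) = least_outside S.
Proof.
move=> wS wm; have [mS _] := least_outsideP wS.
apply: least_outside_eq => [|y]; rewrite !inE negb_or.
  by rewrite eq_sym wm.
by case/andP=> _ /least_outsideP[].
Qed.

End LeastOutside.

(** * Fathers, ancestors and least descendants in a plane tree *)

Section PlaneTreeTheory.

Variables (n : nat) (T : plane_tree n).
Implicit Types (S : {set 'I_n}) (p w : 'I_n).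

Lemma card_fathers w : #|[set p | child T p w]| = (w != tree_root T).
Proof.
by case: (T) => [[r ch] /= H]; case/and3P: (H) => _ /forallP/(_ w)/eqP.
Qed.

Lemma uniq_children p : uniq (children T p).
Proof.
by case: (T) => [[r ch] /= H]; case/and3P: (H) => /forallP/(_ p).
Qed.

Lemma father_unique p q w : child T p w -> child T q w -> p = q.
Proof.
move=> pw qw; have: #|[set p | child T p w]| <= 1.
  by rewrite card_fathers; case: eqP.
by move/card_le1_eqP; apply; rewrite inE.
Qed.

Lemma child_root p : child T p (tree_root T) = false.
Proof.
apply/negP=> pr; have := card_fathers (tree_root T); rewrite eqxx /=.
by move/eqP; rewrite cards_eq0 => /eqP/setP/(_ p); rewrite !inE pr.
Qed.

Lemma descendant_father u p w :
  descendant T u w -> u != w -> child T p w -> descendant T u p.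
Proof.
case/connectP=> q; elim/last_ind: q => [|q x _] /=; first by move=> _ ->; rewrite eqxx.
rewrite rcons_path last_rcons => /andP[uq qx] -> _ px.
by apply/connectP; exists q => //; apply: father_unique px qx.
Qed.

Lemma descendant_child u w :
  descendant T u w -> u != w -> exists2 x, child T u x & descendant T x w.
Proof.
case/connectP=> [[|x q]] /= => [_ ->|]; first by rewrite eqxx.
by case/andP=> ux xq -> _; exists x => //; apply/connectP; exists q.
Qed.

(** All ancestors of a vertex lie on the path from the root to it. *)
Lemma ancestors_comparable u w x :
  descendant T u x -> descendant T w x -> descendant T u w || descendant T w u.
Proof.
move=> ux /connectP[q]; elim/last_ind: q x ux => [|q y IHq] x ux /=.
  by move=> _ <-; rewrite ux.
rewrite rcons_path last_rcons => /andP[wq qy] xy.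
have [uE|uy] := eqVneq u y.
  apply/orP; right; rewrite uE; apply/connectP; exists (rcons q y).
    by rewrite rcons_path wq.
  by rewrite last_rcons.
by apply: (IHq (last w q)) => //; apply: descendant_father uy qy; rewrite -xy.
Qed.

Lemma descendant_beta i : descendant T i (beta T i).
Proof. by rewrite /beta; case: arg_minnP => //; apply: connect0. Qed.

Lemma beta_min i j : descendant T i j -> beta T i <= j.
Proof.
by move=> ij; rewrite /beta; case: arg_minnP => [|k _]; [apply: connect0 | apply].
Qed.

Definition father_closed S := forall p w, child T p w -> w \in S -> p \in S.

Lemma ancestor_closed S u w :
  father_closed S -> descendant T u w -> w \in S -> u \in S.
Proof.
move=> cS /connectP[q]; elim/last_ind: q w => [|q y IHq] w /=; first by move=> _ ->.
rewrite rcons_path last_rcons => /andP[uq qy] -> yS.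
by apply: (IHq (last u q)) => //; apply: cS qy yS.
Qed.

Lemma father_closedU1 S p w :
  father_closed S -> p \in S -> child T p w -> father_closed (w |: S).
Proof.
move=> cS pS pw q x qx; rewrite !inE => /predU1P[xw|xS].
  by rewrite (father_unique qx (q := p)) ?pS ?orbT // xw.
by rewrite (cS q x) ?orbT.
Qed.

Lemma father_closed_root : father_closed [set tree_root T].
Proof. by move=> p w pw /set1P wr; rewrite wr child_root in pw. Qed.

End PlaneTreeTheory.

(** * The vertex through which a partial tree grows *)

Section Attachment.

Variables (N : nat) (T : plane_tree N.+1).
Implicit Types (S : {set 'I_N.+1}) (p w : 'I_N.+1).

(** For S a partial tree containing the root, the path from the root to the
least vertex outside S leaves S at w. *)
Definition attaches S w : bool :=
  [&& w \notin S, descendant T w (least_outside S)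
    & [exists p in S, child T p w]].

(** Two attaching vertices have a common descendant, so one is an ancestor of the
other; if it were a proper one, it would be an ancestor of a father in S. *)
Lemma attaches_unique S u w :
  father_closed T S -> attaches S u -> attaches S w -> u = w.
Proof.
move=> cS; set m := least_outside S.
have below x y : attaches S x -> attaches S y -> descendant T x y -> x = y.
  case/and3P=> xS _ _ /and3P[_ _ /existsP[p /andP[pS py]]] xy.
  apply/eqP; apply: contraNT xS => neq_xy.
  exact: ancestor_closed cS (descendant_father xy neq_xy py) pS.
move=> uA wA; case/and3P: (uA) => _ um _; case/and3P: (wA) => _ wm _.
by case/orP: (ancestors_comparable um wm) => [/below->|/below->].
Qed.

Lemma attaches_exists S x :
  tree_root T \in S -> x \notin S -> exists w, attaches S w.
Proof.
move=> rS xS; have [mS _] := least_outsideP xS.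
have /connectP[q] := Defs.connect_root T (least_outside S).
elim: q (tree_root T) rS => [|y q IHq] r rS /=.
  by move=> _ mE; rewrite mE rS in mS.
case/andP=> ry yq mE; have [yS|yS] := boolP (y \in S); first exact: (IHq y).
exists y; rewrite /attaches yS /=; apply/andP; split.
  by apply/connectP; exists q.
by apply/existsP; exists r; rewrite rS.
Qed.

(** As long as the least outside vertex is not reached it stays the same, so the
tree keeps growing down the same path. *)
Lemma attaches_next S w x :
  father_closed T S -> attaches S w -> w != least_outside S ->
  attaches (w |: S) x -> child T w x.
Proof.
move=> cS wA wm xA; have /and3P[wS wdm /existsP[p /andP[pS pw]]] := wA.
have [y wy ym] := descendant_child wdm wm.
(* By uniqueness, it is enough that the child of w on the path attaches. *)
suff yA : attaches (w |: S) y.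
  by rewrite (attaches_unique (father_closedU1 cS pS pw) xA yA).
rewrite /attaches least_outsideU1 // ym !inE negb_or; apply/and3P; split=> //.
  apply/andP; split; last by apply: contra wS; apply: cS wy.
  by apply: contraNneq wS => yw; rewrite (father_unique (q := p) wy) // yw.
by apply/existsP; exists w; rewrite wy !inE eqxx.
Qed.

End Attachment.

(** * Order of visits of a code *)

Section Visits.

Variable N : nat.
Implicit Types (S : {set 'I_N.+1}) (c : nat -> 'I_N.+1).

(** A father x that is old starts a new path, so the current path has ended at the
least vertex outside.  A new path may also start at that very vertex, but then
x is new and equal to it, and the rule is still right: the code needs no marks
for the ends of paths. *)
Definition next_visit S (x : 'I_N.+1) : 'I_N.+1 :=
  if x \in S then least_outside S else x.

(** Codes are total functions on nat, although only the values at t < N describe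
edges: the last visit, at time N, does not depend on c N, for only one vertex
is left by then. *)
Fixpoint visited c t : {set 'I_N.+1} :=
  if t is s.+1 then next_visit (visited c s) (c t) |: visited c s else [set c 0].

Definition visit c t : 'I_N.+1 :=
  if t is s.+1 then next_visit (visited c s) (c t) else c 0.

Lemma visitedS c t : visited c t.+1 = visit c t.+1 |: visited c t.
Proof. by []. Qed.

Lemma code_visited c t : c t \in visited c t.
Proof.
case: t => [|t]; rewrite ?visitedS !inE //= /next_visit.
by case ct: (c t.+1 \in visited c t); rewrite ?orbT ?eqxx.
Qed.

Lemma mem_visited c t x :
  reflect (exists2 s, s <= t & x = visit c s) (x \in visited c t).
Proof.
elim: t => [|t IHt].
  rewrite inE; apply: (iffP eqP) => [->|[s]]; first by exists 0.
  by rewrite leqn0 => /eqP->.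
rewrite visitedS in_setU1; apply: (iffP predU1P) => [[->|/IHt[s st ->]]|[s]].
- by exists t.+1.
- by exists s => //; apply: leqW.
rewrite leq_eqVlt => /predU1P[->|st] xE; first by left.
by right; apply/IHt; exists s.
Qed.

Lemma visited_mono c s t : s <= t -> visited c s \subset visited c t.
Proof.
move=> st; apply/subsetP=> x /mem_visited[r rs ->]; apply/mem_visited.
by exists r => //; apply: leq_trans st.
Qed.

Lemma next_visit_notin S x y : y \notin S -> next_visit S x \notin S.
Proof.
by move=> /least_outsideP[mS _]; rewrite /next_visit; case: ifP => // /negbT.
Qed.

Lemma card_lt_outside S : #|S| <= N -> exists y, y \notin S.
Proof.
move=> SN; apply/existsP; rewrite -negb_forall; apply/negP=> /forallP allS.
have: #|[set: 'I_N.+1]| <= #|S| by apply/subset_leq_card/subsetP=> x _.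
by rewrite cardsT card_ord leqNgt ltnS SN.
Qed.

Lemma outside_unique S x y : #|S| = N -> x \notin S -> y \notin S -> x = y.
Proof.
move=> SN xS yS; have: #|~: S| <= 1.
  by rewrite -(leq_add2l #|S|) cardsC card_ord SN addn1.
by move/card_le1_eqP; apply; rewrite inE.
Qed.

Lemma card_visited c t : t <= N -> #|visited c t| = t.+1.
Proof.
elim: t => [|t IHt] tN; first exact: cards1.
have ct := IHt (ltnW tN); rewrite visitedS cardsU1 ct.
have [|y yS] := @card_lt_outside (visited c t); first by rewrite ct.
by rewrite (next_visit_notin _ yS).
Qed.

Lemma visit_notin c t : t < N -> visit c t.+1 \notin visited c t.
Proof.
move=> tN; have [|y yS] := @card_lt_outside (visited c t).
  by rewrite card_visited // ltnW.
exact: next_visit_notin yS.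
Qed.

Lemma visit_inj c s t : s <= N -> t <= N -> visit c s = visit c t -> s = t.
Proof.
have lt_neq a b : a < b -> b <= N -> visit c a <> visit c b.
  case: b => // b ab bN eq_ab; have := visit_notin c bN.
  by rewrite -eq_ab => /mem_visited[]; exists a.
by move=> sN tN E; case: (ltngtP s t) => // /lt_neq; [case | case/(_ sN)].
Qed.

Lemma visit_surj c x : exists2 t, t <= N & x = visit c t.
Proof.
apply/mem_visited; suff -> : visited c N = [set: 'I_N.+1] by rewrite inE.
by apply/eqP; rewrite eqEcard subsetT cardsT card_ord card_visited /=.
Qed.

End Visits.

(** * Trees built by a code *)

Section DecodedTree.

Variables (N : nat) (T : plane_tree N.+1) (c : nat -> 'I_N.+1).
Hypothesis root_c : tree_root T = c 0.
Hypothesis child_c : forall t, t < N -> child T (c t) (visit c t.+1).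

Lemma father_closed_visited t : t <= N -> father_closed T (visited c t).
Proof.
elim: t => [|t IHt] tN /=; first by rewrite -root_c; apply: father_closed_root.
exact: father_closedU1 (IHt (ltnW tN)) (code_visited c t) (child_c tN).
Qed.

(** Backward induction on t: the last vertex visited is itself the least one
outside, and an earlier one is either the least one outside or the father of
the next vertex visited. *)
Lemma descendant_visit t :
  t < N -> descendant T (visit c t.+1) (least_outside (visited c t)).
Proof.
move=> tN; have [k Nk] : {k | N = t.+1 + k} by exists (N - t.+1); rewrite subnKC.
elim: k t tN Nk => [|k IHk] t tN Nk.
  have vS := visit_notin c tN; have [mS _] := least_outsideP vS.
  suff -> : least_outside (visited c t) = visit c t.+1 by apply: connect0.
  apply: outside_unique mS vS; rewrite card_visited 1?ltnW //.
  by rewrite Nk addn0.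
have vS := visit_notin c tN.
have [->|vm] := eqVneq (visit c t.+1) (least_outside (visited c t)).
  exact: connect0.
have tN1 : t.+1 < N by rewrite Nk -addSnnS leq_addr.
rewrite -(least_outsideU1 vS vm) -visitedS.
apply: connect_trans (IHk _ tN1 _); last by rewrite addSnnS.
apply: connect1; have := child_c tN1; suff -> : c t.+1 = visit c t.+1 by [].
by move: vm; rewrite /= /next_visit; case: ifP; rewrite ?eqxx.
Qed.

Lemma attaches_visit t : t < N -> attaches T (visited c t) (visit c t.+1).
Proof.
move=> tN; rewrite /attaches visit_notin // descendant_visit //=.
by apply/existsP; exists (c t); rewrite code_visited child_c.
Qed.

(** The visited vertices are closed under ancestors, so no descendant of the new
vertex has been visited. *)
Lemma beta_visit t :
  t < N -> beta T (visit c t.+1) = least_outside (visited c t).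
Proof.
move=> tN; apply/val_inj/eqP; rewrite eqn_leq.
rewrite beta_min ?descendant_visit //=.
suff: beta T (visit c t.+1) \notin visited c t by case/least_outsideP.
apply: contra (visit_notin c tN).
exact: ancestor_closed (father_closed_visited (ltnW tN)) (descendant_beta _ _).
Qed.

(** The least unvisited vertex never decreases; if it were the same at times s
and t, both brothers would attach to the vertices visited at time s. *)
Lemma beta_brothers s t :
  s < t -> t < N -> c s = c t -> beta T (visit c s.+1) < beta T (visit c t.+1).
Proof.
move=> st tN cst; have sN := ltn_trans st tN.
have sub := subsetP (visited_mono c (ltnW st)).
have vt := visit_notin c tN; have [mt _] := least_outsideP vt.
have mt_s : least_outside (visited c t) \notin visited c s.
  by apply: contra mt; apply: sub.
have [ms le_m] := least_outsideP mt_s.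
rewrite !beta_visit // ltn_neqAle le_m andbT; apply/negP=> /eqP/val_inj eq_m.
have tA : attaches T (visited c s) (visit c t.+1).
  rewrite /attaches eq_m descendant_visit // (contra _ vt) //=; last exact: sub.
  by apply/existsP; exists (c s); rewrite code_visited cst child_c.
have /eqP := attaches_unique (father_closed_visited (ltnW sN)) (attaches_visit sN) tA.
by apply/negP; apply: contraNneq vt => <-; apply/mem_visited; exists s.+1.
Qed.

End DecodedTree.

(** The attaching vertex is defined by the tree and the set of visited vertices
alone. *)
Lemma visit_unique N (T : plane_tree N.+1) (c d : nat -> 'I_N.+1) :
  tree_root T = c 0 -> (forall t, t < N -> child T (c t) (visit c t.+1)) ->
  tree_root T = d 0 -> (forall t, t < N -> child T (d t) (visit d t.+1)) ->
  forall t, t <= N -> visit c t = visit d t.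
Proof.
move=> c0 cT d0 dT t tN.
suff [] : visited c t = visited d t /\ visit c t = visit d t by [].
elim: t tN => [|t IHt] tN; first by rewrite /= -c0 -d0.
have [E _] := IHt (ltnW tN); rewrite !visitedS E.
suff -> : visit c t.+1 = visit d t.+1 by [].
have cA := attaches_visit cT tN; rewrite E in cA.
exact: attaches_unique (father_closed_visited d0 dT (ltnW tN)) cA
  (attaches_visit dT tN).
Qed.

(** * Code of a tree *)

Section Encoding.

Variables (N : nat) (T : plane_tree N.+1).

Definition attached (S : {set 'I_N.+1}) : 'I_N.+1 :=
  odflt ord0 [pick w | attaches T S w].

Definition father (w : 'I_N.+1) : 'I_N.+1 := odflt ord0 [pick p | child T p w].

Fixpoint grown t : {set 'I_N.+1} :=
  if t is s.+1 then attached (grown s) |: grown s else [set tree_root T].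

Definition tree_code : {ffun 'I_N -> 'I_N.+1} :=
  [ffun t : 'I_N => father (attached (grown t))].

End Encoding.

(** The default [ord0] is the value at t >= N, which matters only for N = 0: it is
then the root, the only vertex. *)
Definition extend_code N (f : {ffun 'I_N -> 'I_N.+1}) (t : nat) : 'I_N.+1 :=
  oapp f ord0 (insub t).

Lemma extend_codeE N (f : {ffun 'I_N -> 'I_N.+1}) (t : 'I_N) :
  extend_code f t = f t.
Proof. by rewrite /extend_code valK. Qed.

Section EncodingTheory.

Variables (N : nat) (T : plane_tree N.+1).

Lemma child_father S w : attaches T S w -> child T (father T w) w /\ father T w \in S.
Proof.
case/and3P=> _ _ /existsP[p /andP[pS pw]]; rewrite /father.
case: pickP => [q qw|/(_ p)] /=; last by rewrite pw.
by split=> //; rewrite (father_unique qw pw).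
Qed.

Lemma attachedP S w : attaches T S w -> attaches T S (attached T S).
Proof. by move=> wA; rewrite /attached; case: pickP => [//|/(_ w)]; rewrite wA. Qed.

Lemma grown_spec t : t <= N ->
  [/\ father_closed T (grown T t), tree_root T \in grown T t & #|grown T t| = t.+1].
Proof.
elim: t => [|t IHt] tN /=.
  by split; [exact: father_closed_root | rewrite inE | exact: cards1].
have [cS rS St] := IHt (ltnW tN).
have [|x xS] := @card_lt_outside _ (grown T t); first by rewrite St.
have [w /attachedP wA] := attaches_exists rS xS.
have [wf fS] := child_father wA; have /andP[wS _] := wA.
split; [exact: father_closedU1 cS fS wf | by rewrite !inE rS orbT |].
by rewrite cardsU1 wS St.
Qed.

Lemma grown_attaches t : t < N -> attaches T (grown T t) (attached T (grown T t)).
Proof.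
move=> tN; have [cS rS St] := grown_spec (ltnW tN).
have [|x xS] := @card_lt_outside _ (grown T t); first by rewrite St.
by have [w /attachedP] := attaches_exists rS xS.
Qed.

Let c := extend_code (tree_code T).

Lemma tree_codeP t : t < N ->
  child T (c t) (attached T (grown T t)) /\ c t \in grown T t.
Proof.
move=> tN; rewrite /c (extend_codeE _ (Ordinal tN)) ffunE.
exact: child_father (grown_attaches tN).
Qed.

Lemma tree_code_root : tree_root T = c 0.
Proof.
have [N0|/tree_codeP[_]] := posnP N; last by rewrite inE => /eqP.
by apply: (@outside_unique _ set0); rewrite ?inE ?cards0.
Qed.

(** The decoding rule recovers the growth of the tree.  Let w attach at time t.
If w is the least vertex outside, then the next father is w or an old vertex,
and the rule gives w in both cases; otherwise the next father is w, by
[attaches_next]. *)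
Lemma next_visit_tree_code t :
  t < N -> next_visit (grown T t) (c t.+1) = attached T (grown T t).
Proof.
move=> tN; have [cS rS St] := grown_spec (ltnW tN).
have wA := grown_attaches tN; have /andP[wS _] := wA.
move: tN; rewrite leq_eqVlt => /predU1P[tN|tN].
  (* At the last step there is only one vertex left to attach. *)
  by apply: (@outside_unique _ (grown T t)); rewrite ?(next_visit_notin _ wS) // St.
have [cw] := tree_codeP tN; rewrite /= !inE /next_visit.
have [wm|wm] := eqVneq (attached T (grown T t)) (least_outside (grown T t)).
  by rewrite -wm; case: (c t.+1 \in _); rewrite // orbF => /eqP.
have ww := attaches_next cS wA wm (grown_attaches tN).
by rewrite (father_unique cw ww) (negbTE wS).
Qed.

Lemma visited_tree_code t : t <= N -> visited c t = grown T t.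
Proof.
elim: t => [|t IHt] tN; first by rewrite /= -tree_code_root.
by rewrite /= (IHt (ltnW tN)) next_visit_tree_code.
Qed.

Lemma child_tree_code t : t < N -> child T (c t) (visit c t.+1).
Proof.
move=> tN; rewrite /= visited_tree_code ?next_visit_tree_code // 1?ltnW //.
by case: (tree_codeP tN).
Qed.

End EncodingTheory.

(** * Younger children and right-to-left minima *)

(** Elder vertices are defined by comparing least descendants of brothers, so the
number of younger children depends only on the relative order of these. *)
Lemma young_RLmin N (T : plane_tree N.+1) (i : 'I_N.+1) (s : seq nat) :
  uniq s -> size (children T i) = size s ->
  (forall a b, a < size s -> b < size s ->
    (beta T (nth ord0 (children T i) a) < beta T (nth ord0 (children T i) b))
      = (nth 0 s a < nth 0 s b)) ->
  young T i = RLmin s.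
Proof.
move=> us sz beta_nth; pose v (a : 'I_(size s)) := nth ord0 (children T i) a.
have va b : v b \in children T i by rewrite mem_nth ?sz.
have vK b : index (v b) (children T i) = b by rewrite index_uniq ?sz ?uniq_children.
have v_inj : injective v by move=> a b vab; apply/val_inj; rewrite /= -vK vab vK.
have young_v a : younger T (v a) = is_RLmin s a.
  apply/existsPn/forallP => [none b | min_a k].
    apply/implyP=> ab; have := none (v b); rewrite negb_and beta_nth // -leqNgt.
    case/orP=> [/existsPn/(_ i)|le_ab]; first by rewrite !va !vK ab.
    by rewrite ltn_neqAle le_ab nth_uniq // neq_ltn ab.
  apply/negP=> /andP[/existsP[i' /and3P[ai' ki' ak]]].
  have i'E : i' = i by apply: father_unique ai' (va a).
  rewrite {}i'E vK in ki' ak *; have kb := ki'; rewrite -index_mem sz in kb.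
  have kE : k = v (Ordinal kb) by rewrite /v nth_index.
  rewrite kE beta_nth // ltnNge ltnW //.
  exact: implyP (min_a (Ordinal kb)) ak.
rewrite /RLmin -(card_imset _ v_inj); apply: eq_card => j; rewrite inE.
apply/andP/imsetP => [[ji jy]|[a]]; last by rewrite inE -young_v => ay ->.
have ja : index j (children T i) < size s by rewrite -sz index_mem.
have jE : j = v (Ordinal ja) by rewrite /v nth_index.
by exists (Ordinal ja) => //; rewrite inE -young_v -jE.
Qed.

(** * Dispositions and plane trees *)

Section Decoding.

Variable N : nat.
Implicit Type D : disposition N N.+1.

Definition code D : nat -> 'I_N.+1 := extend_code D.1.

Definition visit_at (c : nat -> 'I_N.+1) (t : 'I_N) : 'I_N.+1 := visit c t.+1.

Lemma visit_at_inj c : injective (visit_at c).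
Proof. by move=> s t /visit_inj E; apply/val_inj/succn_inj/E; apply: ltn_ord. Qed.

Definition decode_data D : 'I_N.+1 * {ffun 'I_N.+1 -> seq 'I_N.+1} :=
  (code D 0, [ffun i => [seq visit_at (code D) t | t <- D.2 i]]).

Lemma mem_disp D i t : (t \in D.2 i) = (D.1 t == i).
Proof.
case: D => [[f D] /= /forallP/(_ i)/perm_mem->].
by rewrite mem_enum inE.
Qed.

Lemma uniq_disp D i : uniq (D.2 i).
Proof.
by case: D => [[f D] /= /forallP/(_ i)/perm_uniq->]; apply: enum_uniq.
Qed.

Lemma mem_decode D i t : (visit_at (code D) t \in (decode_data D).2 i) = (D.1 t == i).
Proof. by rewrite ffunE (mem_map (@visit_at_inj _)) mem_disp. Qed.

Lemma decode_subproof D : is_plane_tree (decode_data D).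
Proof.
have ffunD i : (decode_data D).2 i = [seq visit_at (code D) t | t <- D.2 i].
  by rewrite ffunE.
apply/and3P; split; apply/forallP=> j.
- by rewrite ffunD (map_inj_uniq (@visit_at_inj _)) uniq_disp.
- have [[|t] tN ->] := visit_surj (code D) j.
    rewrite eqxx cards_eq0; apply/eqP/setP=> i; rewrite !inE /child_rel ffunD.
    by apply/mapP=> -[s _ /visit_inj]; case/(_ isT (ltn_ord s)).
  have -> : visit (code D) t.+1 != code D 0.
    by apply/eqP=> /(@visit_inj _ _ _ 0 tN isT).
  apply/cards1P; exists (D.1 (Ordinal tN)); apply/setP=> i.
  by rewrite !inE /child_rel (mem_decode D i (Ordinal tN)) eq_sym.
have [t tN ->] := visit_surj (code D) j.
elim/ltn_ind: t tN => -[|t] IHt tN; first exact: connect0.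
have /mem_visited[s st cE] := code_visited (code D) t.
apply: connect_trans (IHt s st (leq_trans st (ltnW tN))) (connect1 _).
rewrite -cE /child_rel (mem_decode D _ (Ordinal tN)).
by rewrite /code (extend_codeE _ (Ordinal tN)).
Qed.

Definition decode D : plane_tree N.+1 := PlaneTree (decode_subproof D).

Lemma children_decode D i : children (decode D) i = map (visit_at (code D)) (D.2 i).
Proof. by rewrite /children ffunE. Qed.

Lemma child_decode D t : t < N -> child (decode D) (code D t) (visit (code D) t.+1).
Proof.
move=> tN; rewrite /child /children (mem_decode D _ (Ordinal tN)).
by rewrite /code (extend_codeE _ (Ordinal tN)).
Qed.

Lemma decode_inj : injective decode.
Proof.
move=> D E DE; have rootE : tree_root (decode D) = code E 0 by rewrite DE.
have childE t : t < N -> child (decode D) (code E t) (visit (code E) t.+1).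
  by rewrite DE; apply: child_decode.
have eq_visit : visit_at (code D) =1 visit_at (code E).
  by move=> t; apply: (visit_unique _ (@child_decode D) rootE childE).
apply/val_inj; rewrite [LHS]surjective_pairing [RHS]surjective_pairing.
congr pair; apply/ffunP=> i /=.
  rewrite -!extend_codeE; apply: father_unique (child_decode D (ltn_ord i)) _.
  by have := childE i (ltn_ord i); rewrite -[visit _ _]eq_visit.
apply: (inj_map (@visit_at_inj (code D))).
by rewrite -children_decode DE children_decode; apply: eq_map.
Qed.

(** The sequences D_i list the visiting times of the children of i; the times are
found through the partial inverse g of the visits, which is defined on every
vertex but the root. *)
Lemma decode_surj T : exists D, decode D = T.
Proof.
pose f := tree_code T; pose c := extend_code f.
pose g w : option 'I_N := [pick t | visit_at c t == w].
have gK : ocancel g (visit_at c).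
  by move=> w; rewrite /g; case: pickP => [t /eqP|].
pose L : {ffun 'I_N.+1 -> seq 'I_N} := [ffun i => pmap g (children T i)].
have LE i : map (visit_at c) (L i) = children T i.
  rewrite ffunE (pmap_filter gK); apply/all_filterP/allP=> w wi.
  have [[|t] tN wE] := visit_surj c w.
    by move: wi; rewrite wE -[visit c 0]tree_code_root -/(child T i _) child_root.
  by rewrite /g; case: pickP => [//|/(_ (Ordinal tN))]; rewrite wE eqxx.
have LD : is_disposition (f, L).
  apply/forallP=> i; apply: uniq_perm; rewrite ?enum_uniq //.
    by apply: (map_uniq (f := visit_at c)); rewrite LE uniq_children.
  move=> t; rewrite mem_enum inE -(mem_map (@visit_at_inj c)) LE.
  have ft := child_tree_code T (ltn_ord t); rewrite extend_codeE in ft.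
  apply/idP/eqP=> [|<- //]; exact: father_unique ft.
exists (Disposition LD); apply/val_inj.
rewrite [RHS]surjective_pairing; congr pair; first exact/esym/tree_code_root.
by apply/ffunP=> i; rewrite ffunE; apply: LE.
Qed.

Lemma young_decode D i :
  young (decode D) i = RLmin (map (@nat_of_ord _) (disp_seq D i)).
Proof.
have chE := children_decode D i; set T := decode D in chE *.
apply: young_RLmin => [||a b].
- by rewrite (map_inj_uniq val_inj) uniq_disp.
- by rewrite chE !size_map.
have beta_lt t u : t \in D.2 i -> u \in D.2 i -> t < u ->
    beta T (visit_at (code D) t) < beta T (visit_at (code D) u).
  rewrite !mem_disp => /eqP ti /eqP ui tu.
  apply: (beta_brothers _ (@child_decode D)) => //.
  by rewrite /code !extend_codeE ti ui.
rewrite /disp_seq size_map => aD bD.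
have [t0 _] : exists t0 : 'I_N, t0 \in D.2 i.
  by case: (D.2 i) aD => [|t0 l _] //; exists t0; rewrite inE eqxx.
rewrite chE !(nth_map t0) //.
have := mem_nth t0 aD; have := mem_nth t0 bD.
move: (nth t0 _ a) (nth t0 _ b) => t u uD tD.
case: (ltngtP t u) => [/beta_lt->//|ut|/val_inj->]; last exact: ltnn.
by apply/negbTE; rewrite -leqNgt ltnW // beta_lt.
Qed.

End Decoding.

Theorem theorem3p1 (n : nat) (hn : 1 <= n) :
  exists phi : plane_tree n -> disposition n.-1 n,
    bijective phi /\
    (forall (T : plane_tree n) (i : 'I_n),
        young T i = RLmin (map (@nat_of_ord _) (disp_seq (phi T) i))).
Proof.
case: n hn => // N _.
have surj (T : plane_tree N.+1) : exists D, decode D == T.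
  by have [D /eqP] := decode_surj T; exists D.
pose phi T := xchoose (surj T).
have phiK : cancel phi (@decode N) by move=> T; apply/eqP/(xchooseP (surj T)).
exists phi; split; last by move=> T i; rewrite -young_decode phiK.
by exists (@decode N) => // D; apply: decode_inj; rewrite phiK.
Qed.
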